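(* For every $k\ge1$, as formal power series, $$I_k(x)=I_{k-1}(x)+C_kx^kI_{k-1}(x)U_k(x)\qquad\text{and}\qquad U_k(x)=U_{k-1}(x)+C_kx^kU_{k-1}(x)U_k(x).$$
   Context: $C_k=\frac1{k+1}\binom{2k}{k}$ is the $k$-th Catalan number. Parking rules: $n$ spots $1,\dots,n$; cars $c_1,\dots,c_n$ arrive in order with preferences $a_j\in[n]$; $k$-Naples rule: $c_j$ parks at $a_j$ if empty, otherwise checks spots $a_j-1,\dots,a_j-k$ (those $\ge1$) in order and parks in the first empty one, otherwise drives forward from $a_j$ and parks in the first empty spot after $a_j$ (failing if none); a $k$-Naples parking function is a preference for which all cars park, and $0$-Naples parking functions are ordinary parking functions. $I_{n,k}$ is the number of ascending (weakly increasing) $k$-Naples parking functions of length $n$ and $U_{n,k}$ the number of those with first entry $1$; conventions: $I_{n,0}=C_n$ for $n\ge0$ (so $I_{0,k}=1$), $U_{n,0}=C_n$ for $n\ge1$, $U_{0,k}=0$ for all $k\ge0$. Set $I_k(x)=\sum_{n\ge0}I_{n,k}x^n$ and $U_k(x)=\sum_{n\ge0}U_{n,k}x^n$. *)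

(* Defs.v *)
From mathcomp Require Import all_boot all_order all_algebra.

Set Implicit Arguments.
Unset Strict Implicit.
Unset Printing Implicit Defensive.

Import GRing.Theory.

(* The division is exact: k+1 divides the central binomial coefficient. *)
Definition catalan (k : nat) : nat := 'C(2 * k, k) %/ k.+1.

(* Spots are the naturals 1, ..., n.  These are the spots that a car preferring
   spot a (1 <= a <= n) inspects, in order: a itself, then a-1, ..., a-k
   (only those >= 1), then a+1, ..., n. *)
Definition inspected (n k a : nat) : seq nat :=
  a :: [seq a - i | i <- iota 1 k & i < a] ++ iota a.+1 (n - a).

Definition naples_spot (n k : nat) (occ : seq nat) (a : nat) : option nat :=
  ohead [seq s <- inspected n k a | s \notin occ].

Fixpoint all_park (n k : nat) (occ p : seq nat) : bool :=
  if p is a :: p' then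
    if naples_spot n k occ a is Some s then all_park n k (s :: occ) p'
    else false
  else true.

(* An element i of 'I_n encodes the preference i+1 in {1, ..., n}. *)
Definition prefs (n : nat) (t : n.-tuple 'I_n) : seq nat :=
  [seq (val i).+1 | i : 'I_n <- t].

Definition naples_pf (n k : nat) (t : n.-tuple 'I_n) : bool :=
  all_park n k [::] (prefs t).

Definition ascending (n : nat) (t : n.-tuple 'I_n) : bool :=
  sorted leq (prefs t).

Definition I_num (n k : nat) : nat :=
  #|[set t : n.-tuple 'I_n | ascending t & naples_pf k t]|.

(* For n = 0 there is no first entry, so U_num 0 k = 0. *)
Definition U_num (n k : nat) : nat :=
  #|[set t : n.-tuple 'I_n |
      [&& ascending t, naples_pf k t & ohead (prefs t) == Some 1]]|.

Local Open Scope ring_scope.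

(* Formal power series over int, given by their coefficient sequences; they are
   compared with =1, i.e. coefficient by coefficient. *)
Definition fps : Type := nat -> int.

Definition fps_add (f g : fps) : fps := fun n => f n + g n.

Definition fps_mul (f g : fps) : fps :=
  fun n => \sum_(i < n.+1) f i * g (n - i)%N.

Definition fps_monomial (c : int) (m : nat) : fps :=
  fun n => if n == m then c else 0.

Declare Scope fps_scope.
Delimit Scope fps_scope with fps.
Bind Scope fps_scope with fps.
Notation "f + g" := (fps_add f g) : fps_scope.
Notation "f * g" := (fps_mul f g) : fps_scope.

Definition I_gf (k : nat) : fps := fun n => (I_num n k)%:Z.
Definition U_gf (k : nat) : fps := fun n => (U_num n k)%:Z.

(* Main.v *)
(* Process the spots from left to right.  After spot i, call i deficient if fewer
   than i cars prefer a spot at most i.  While a spot g is empty, a car preferring a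
   spot at most g + k never drives forward, so the first spot of a maximal run of
   deficient spots gets filled exactly when the run has length at most k.  Ascending k-Naples parking
   functions are thus the lattice paths all of whose excursions below the diagonal
   have length at most k.  Splitting such a path at its first excursion of length
   exactly k gives a (k-1)-Naples path, one of the C_k excursions of length k, and a
   k-Naples path starting with a car that prefers spot 1. *)
Require Import Defs.
From mathcomp Require Import all_boot all_order all_algebra.
From mathcomp Require Import zify.

Import GRing.Theory.

(** * Ballot numbers and Catalan numbers *)

(* Number of ways to stay below the diagonal for t more spots, from depth d. *)
Fixpoint ballot (t d : nat) : nat :=
  if t is t'.+1 then \sum_(e < d.+1) ballot t' e.+1 else 1.

Lemma ballotS0 t : ballot t.+1 0 = ballot t 1.
Proof. by rewrite /= big_ord_recl big_ord0 addn0. Qed.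

Lemma ballotSS t d : ballot t.+1 d.+1 = ballot t.+1 d + ballot t d.+2.
Proof. by rewrite /= big_ord_recr. Qed.

(** The reflection formula, with its subtraction moved across. Both sides obey Pascal's rule, so an
    induction on [t] and then [d] suffices. *)
Lemma ballot_bin t d : ballot t.+1 d + 'C(2 * t.+1 + d, t) = 'C(2 * t.+1 + d, t.+1).
Proof.
elim: t d => [|t IHt] d; elim: d => [|d IHd].
- by rewrite ballotS0.
- by rewrite ballotSS [ballot 0 _]/=; move: IHd; rewrite !bin0 !bin1; lia.
- have := IHt 1; rewrite ballotS0.
  have -> : 2 * t.+2 + 0 = (2 * t.+1 + 1).+1 by lia.
  (* At depth 0, Pascal's rule leaves the two middle binomials of an odd row, equal by symmetry. *)
  have [le eN] : t.+1 <= 2 * t.+1 + 1 /\ 2 * t.+1 + 1 - t.+1 = t.+2 by lia.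
  move: (2 * t.+1 + 1) le eN => N le eN.
  by have := bin_sub le; rewrite eN !binS; lia.
- rewrite ballotSS; have := IHt d.+2; move: IHd.
  rewrite (_ : 2 * t.+2 + d.+1 = (2 * t.+2 + d).+1); last by lia.
  rewrite (_ : 2 * t.+1 + d.+2 = 2 * t.+2 + d); last by lia.
  by rewrite !binS; lia.
Qed.

Lemma ballot_catalan k : ballot k 0 = catalan k.
Proof.
case: k => [|k]; first by [].
have H := ballot_bin k 0; rewrite addn0 in H.
(* The ratio of the two binomials in [H] makes their difference the central one divided by [k.+2],
   exactly. *)
have E := mul_bin_left (2 * k.+1) k.
rewrite /catalan; suff -> : 'C(2 * k.+1, k.+1) = ballot k.+1 0 * k.+2 by rewrite mulnK.
have : 2 * k.+1 - k = k.+2 by lia.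
by move=> E2; rewrite E2 in E; nia.
Qed.

(** * Paths with bounded runs, split at the first run of maximal length *)

(* Number of ways to distribute the last m cars over the last q spots when the
   current run of deficient spots has length r.  As cars and spots are equally many,
   the spot just processed is deficient iff m > q. *)
Fixpoint completions (k q m r : nat) : nat :=
  if k < r then 0
  else if q is q'.+1 then
    \sum_(m' < m.+1) completions k q' m' (if m' <= q' then 0 else r.+1)
  else (m == 0).

(* n cars on n spots, at least one of them preferring the first spot. *)
Definition rooted_completions (k n : nat) : nat :=
  if n is n'.+1 then \sum_(m < n) completions k n' m 0 else 0.

Lemma completions_gt k q m r : k < r -> completions k q m r = 0.
Proof. by case: q => [|q] /= ->. Qed.

Lemma completionsS k q m r : r <= k ->
  completions k q.+1 m r =
    \sum_(m' < m.+1) completions k q m' (if m' <= q then 0 else r.+1).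
Proof. by rewrite leqNgt => /negbTE /= ->. Qed.

Lemma completions0 k m r : r <= k -> completions k 0 m r = (m == 0).
Proof. by rewrite leqNgt => /negbTE /= ->. Qed.

(* Reindexing by the left-over count m'' = i + m' - q. *)
Lemma exchange_shift (G : nat -> nat -> nat) (w : nat -> nat) q m :
  \sum_(m' < m.+1) \sum_(i < q.+1 | q <= i + m') G i (i + m' - q) * w i =
  \sum_(i < q.+1 | q <= i + m) (\sum_(m'' < (i + m - q).+1) G i m'') * w i.
Proof.
rewrite (exchange_big_dep (fun i : 'I_q.+1 => q <= i + m)) /=; last first.
  by move=> m' i _; have := ltn_ord m'; lia.
apply: eq_bigr => i Hi; rewrite big_distrl /=.
have Hiq := ltn_ord i.
rewrite -(big_mkord xpredT (fun x => G i x * w i)).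
rewrite -(big_mkord (fun x => q <= i + x) (fun x => G i (i + x - q) * w i)).
rewrite (@big_cat_nat _ _ _ (q - i)) /=; [|by lia|by lia].
rewrite big_nat_cond big_pred0 ?add0n; last by move=> x; lia.
rewrite -{1}[q - i]add0n big_addn.
rewrite (_ : m.+1 - (q - i) = (i + m - q).+1); last by lia.
rewrite big_nat_cond [RHS]big_nat_cond; apply: eq_big => x; first by lia.
by move=> _; congr (G i _ * _); lia.
Qed.

(* Paths whose first run of length K.+1 lies ahead, up to the factor C_(K.+1): this
   run starts after i more spots, and cutting there leaves i + m - q cars before. *)
Definition first_long (K q m r : nat) : nat :=
  \sum_(i < q.+1 | q <= i + m)
    completions K i (i + m - q) r * rooted_completions K.+1 (q - i - K.+1).

(* Paths whose first run of length K.+1 is the run in progress. *)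
Definition current_long (K q m r : nat) : nat :=
  if q < m then ballot (K.+1 - r) (m - q) * rooted_completions K.+1 (q - (K.+1 - r)) else 0.

Lemma first_long_gt K q m r : K < r -> first_long K q m r = 0.
Proof. by move=> hr; rewrite /first_long big1 // => i _; rewrite completions_gt. Qed.

(** The long run either starts at once, which forces the path to be on the diagonal ([m = q.+1], the
    term i = 0), or starts after the next spot. *)
Lemma first_longS K q m r : r <= K ->
  first_long K q.+1 m r = (m == q.+1) * rooted_completions K.+1 (q.+1 - K.+1) +
    \sum_(m' < m.+1) first_long K q m' (if m' <= q then 0 else r.+1).
Proof.
move=> hr.
pose w i := rooted_completions K.+1 (q - i - K.+1).
pose G i m'' := completions K i m'' (if m'' <= i then 0 else r.+1).
have -> : \sum_(m' < m.+1) first_long K q m' (if m' <= q then 0 else r.+1) =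
  \sum_(m' < m.+1) \sum_(i < q.+1 | q <= i + m') G i (i + m' - q) * w i.
  apply: eq_bigr => m' _; apply: eq_bigr => i Hi; rewrite /G.
  by rewrite (_ : (i + m' - q <= i) = (m' <= q)) //; have := ltn_ord i; lia.
rewrite exchange_shift /first_long big_mkcond big_ord_recl.
congr (_ + _).
  rewrite [nat_of_ord _]/= add0n completions0 // subn0 subn_eq0.
  by rewrite eqn_leq; case: (q < m); rewrite ?andbT ?andbF.
rewrite big_mkcond [RHS]big_mkcond; apply: eq_bigr => i _.
rewrite lift0 addSn ltnS; case: ifP => // h.
rewrite !subSS completionsS //; congr (_ * _).
Qed.

(** Paths are classified by their first run of length [K.+1]: none, ahead, or in progress. The spot
    after such a run must end it; removing from that spot as many cars as the depth reached leaves a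
    rooted path, whatever the depth, so the two factors are independent. *)
Lemma completionsSk K q m r : r <= K.+1 -> (m <= q -> r = 0) ->
  completions K.+1 q m r =
    completions K q m r + catalan K.+1 * first_long K q m r + current_long K q m r.
Proof.
elim: q m r => [|q IHq] m r hr h0.
  have [hrK|hrK] := leqP r K.
    rewrite !completions0 // /first_long big_mkcond big_ord_recl big_ord0 /= .
    rewrite /current_long /= ?sub0n.
    by case: ifP => _; case: m h0 => [|m] h0 //=; rewrite ?muln0 ?addn0.
  have -> : r = K.+1 by lia.
  rewrite completions0 // completions_gt //.
  rewrite first_long_gt //.
  rewrite /current_long subnn; case: m h0 => [|m] h0; last by rewrite /= muln0.
  by have := h0 isT; lia.
have [hrK|hrK] := leqP r K; last first.
  have er : r = K.+1 by lia.
  have hm : q.+1 < m by case: (leqP m q.+1) => // /h0; lia.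
  rewrite er completionsS // completions_gt //.
  rewrite first_long_gt //.
  rewrite /current_long subnn subn0 hm muln0 /= mul1n.
  rewrite -(big_mkord xpredT (fun x => completions K.+1 q x (if x <= q then 0 else K.+2))).
  (* The run is already maximal: beyond the cut its length would be [K.+2], and those terms
     vanish. *)
  rewrite (@big_cat_nat _ _ _ q.+1) //=; last by lia.
  rewrite [X in _ + X]big_nat [X in _ + X]big1 ?addn0 => [|i hi]; last first.
    by case: leqP hi => [|_ _]; [lia | rewrite completions_gt].
  by rewrite big_mkord; apply: eq_bigr => i _; rewrite -ltnS ltn_ord.
rewrite !completionsS // first_longS // mulnDr.
transitivity (\sum_(m' < m.+1) (completions K q m' (if m' <= q then 0 else r.+1) +
   catalan K.+1 * first_long K q m' (if m' <= q then 0 else r.+1) +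
   current_long K q m' (if m' <= q then 0 else r.+1))).
  by apply: eq_bigr => m' _; case: ifP => h; apply: IHq; lia.
rewrite !big_split /= -big_distrr /= -!addnA; congr (_ + _).
rewrite [RHS]addnCA; congr (_ + _).
(* What is left concerns runs in progress after the next spot. For m > q.+1 they continue the
   present run; for m = q.+1 they start on the diagonal, where [ballot K.+1 0] is the Catalan
   factor; for m <= q there are none. *)
rewrite -(big_mkord xpredT (fun x => current_long K q x (if x <= q then 0 else r.+1))).
have [hm|hm] := leqP m q.
  rewrite big_nat big1 => [|i hi].
    by rewrite /current_long; case: ltnP; case: eqP; lia.
  by rewrite /current_long; case: ltnP => //; lia.
rewrite (@big_cat_nat _ _ _ q.+1) //=; last by lia.
rewrite big_nat big1 => [|i hi]; last by rewrite /current_long; case: ltnP => //; lia.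
rewrite add0n -{1}[q.+1]add0n big_addn big_mkord.
have -> : \sum_(i < m.+1 - q.+1) current_long K q (i + q.+1)
     (if i + q.+1 <= q then 0 else r.+1) =
   ballot (K.+1 - r) (m - q.+1) * rooted_completions K.+1 (q.+1 - (K.+1 - r)).
  have -> : K.+1 - r = (K - r).+1 by lia.
  rewrite /= big_distrl /= (_ : m.+1 - q.+1 = (m - q.+1).+1); last by lia.
  apply: eq_bigr => i _; rewrite /current_long.
  have -> : (i + q.+1 <= q) = false by lia.
  have -> : q < i + q.+1 by lia.
  rewrite (_ : K.+1 - r.+1 = K - r); last by lia.
  by rewrite (_ : i + q.+1 - q = i.+1) ?subSS //; lia.
rewrite /current_long; case: eqP => [e|ne].
  have -> : r = 0 by apply: h0; lia.
  by rewrite e ltnn addn0 subnn subn0 ballot_catalan mul1n.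
by rewrite (_ : q.+1 < m) ?muln0 //; lia.
Qed.

Lemma completions_rec K n :
  completions K.+1 n n 0 = completions K n n 0 +
    catalan K.+1 * \sum_(i < n.+1) completions K i i 0 * rooted_completions K.+1 (n - i - K.+1).
Proof.
rewrite completionsSk // /current_long ltnn addn0; congr (_ + _ * _).
rewrite /first_long; apply: eq_big => i; first by rewrite leq_addl.
by rewrite addnK.
Qed.

Lemma rooted_completions_rec K n :
  rooted_completions K.+1 n = rooted_completions K n +
    catalan K.+1 * \sum_(i < n.+1) rooted_completions K i * rooted_completions K.+1 (n - i - K.+1).
Proof.
rewrite big_ord_recl mul0n add0n; case: n => [|n]; first by rewrite big_ord0 muln0.
rewrite {1 2}/rooted_completions.
pose w i := rooted_completions K.+1 (n - i - K.+1).
(* The part before the long run is rooted too: summing over the cars left after the first spot,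
   [exchange_shift] collects it into [rooted_completions K i.+1]. *)
have -> : \sum_(i < n.+1) rooted_completions K (bump 0 i) *
   rooted_completions K.+1 (n.+1 - bump 0 i - K.+1) = \sum_(m < n.+1) first_long K n m 0.
  rewrite /first_long (exchange_shift (fun i m => completions K i m 0) w).
  apply: eq_big => i; first by rewrite leq_addl.
  by rewrite /bump /= add1n subSS addnK.
rewrite big_distrr -big_split /=; apply: eq_bigr => m _.
rewrite completionsSk // /current_long ifF ?addn0 //.
by have := ltn_ord m; lia.
Qed.

(** * The spot taken by a single car *)

Lemma ohead_filter_sorted (T : eqType) (R : rel T) (P : pred T) (l : seq T) s :
  transitive R -> sorted R l -> ohead (filter P l) = Some s ->
  [/\ s \in l, P s & forall t, t \in l -> P t -> t = s \/ R s t].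
Proof.
move=> trR sl; have := sorted_filter trR P sl.
have mf x : (x \in filter P l) = P x && (x \in l) by rewrite mem_filter.
case: (filter P l) mf => [|x f] // mf sf [<-].
have /andP[Px xl] : P x && (x \in l) by rewrite -mf mem_head.
split=> // t tl Pt.
have : t \in x :: f by rewrite mf Pt.
rewrite inE => /orP[/eqP ->|tf]; first by left.
by right; apply: (allP (order_path_min trR sf)).
Qed.

Lemma ohead_filter_none (T : eqType) (P : pred T) (l : seq T) t :
  ohead (filter P l) = None -> t \in l -> ~~ P t.
Proof.
have := mem_filter P t l; case: (filter P l) => // + _ tl.
by rewrite tl andbT in_nil => <-.
Qed.

Lemma ohead_cat (T : Type) (s t : seq T) :
  ohead (s ++ t) = if ohead s is Some x then Some x else ohead t.
Proof. by case: s. Qed.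

(** Joining [a] itself (i = 0) to the spots behind it gives one decreasing list, whose first empty
    spot is its largest. *)
Definition backward_spots (k a : nat) : seq nat :=
  [seq a - i | i <- iota 0 k.+1 & i < a].

Lemma inspectedE n k a : 0 < a ->
  inspected n k a = backward_spots k a ++ iota a.+1 (n - a).
Proof. by rewrite /inspected /backward_spots /= => ->; rewrite /= subn0. Qed.

Lemma mem_backward_spots k a t :
  (t \in backward_spots k a) = [&& 0 < t, t <= a & a <= t + k].
Proof.
apply/mapP/idP => [[i]|h].
  by rewrite mem_filter mem_iota => + ->; lia.
by exists (a - t); rewrite ?mem_filter ?mem_iota; lia.
Qed.

Lemma sorted_backward_spots k a : sorted gtn (backward_spots k a).
Proof.
have := sorted_filter ltn_trans (fun i => i < a) (iota_ltn_sorted 0 k.+1).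
apply: (homo_sorted_in (P := [pred i | i < a])) (filter_all _ _) => x y.
by rewrite !inE /gtn /=; lia.
Qed.

(** One conclusion serves both ways of parking: the first universal clause is vacuous if the car
    drives forward, the second if it does not. *)
Lemma naples_spot_some n k occ a s : 0 < a <= n -> naples_spot n k occ a = Some s ->
  [/\ s \notin occ, 0 < s <= n, a <= s + k,
      (forall t, s < t <= a -> t \in occ) &
      (forall t, 0 < t < s -> a < s -> a <= t + k -> t \in occ)].
Proof.
case/andP=> a0 an; rewrite /naples_spot inspectedE // filter_cat ohead_cat.
case E : (ohead [seq _ <- backward_spots k a | _]) => [x|].
  have gt_trans : transitive gtn by move=> y x' z; rewrite /gtn /=; lia.
  case: (ohead_filter_sorted _ _ _ _ _ gt_trans (sorted_backward_spots k a) E).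
  rewrite mem_backward_spots => xa xo xP [<-]; split=> //; try lia.
    move=> t tx; apply/negPn/negP => to.
    by case: (xP t) => //; rewrite ?mem_backward_spots /gtn /=; lia.
move=> H; case: (ohead_filter_sorted _ _ _ _ _ ltn_trans (iota_ltn_sorted a.+1 (n - a)) H).
rewrite mem_iota => xa xo xP; split=> //; try lia.
move=> t ts sa ta; have [ht|ht] := leqP t a.
  apply/negPn; apply: (ohead_filter_none _ _ _ _ E).
  by rewrite mem_backward_spots; lia.
apply/negPn/negP => to.
by case: (xP t) => //; rewrite ?mem_iota; lia.
Qed.

Lemma naples_spot_none n k occ a t : 0 < a <= n -> naples_spot n k occ a = None ->
  0 < t <= n -> a <= t + k -> t \in occ.
Proof.
case/andP=> a0 an; rewrite /naples_spot inspectedE // => H ht ta.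
apply/negPn; apply: (ohead_filter_none _ _ _ _ H).
by rewrite mem_cat mem_backward_spots mem_iota; lia.
Qed.

(** * The parking invariant, spot by spot *)

Lemma uniq_interval_full occ m : uniq occ -> m <= size occ ->
  (forall x, x \in occ -> 0 < x <= m) -> forall x, 0 < x <= m -> x \in occ.
Proof.
move=> uo sz sub x hx.
have sub' : {subset occ <= iota 1 m} by move=> y /sub; rewrite mem_iota; lia.
have [|_ ->] := uniq_min_size uo sub'; first by rewrite size_iota.
by rewrite mem_iota; lia.
Qed.

Lemma interval_size_le occ m : (forall x, 0 < x <= m -> x \in occ) -> m <= size occ.
Proof.
move=> h; rewrite -(size_iota 1 m); apply: uniq_leq_size (iota_uniq _ _) _.
by move=> x; rewrite mem_iota => hx; apply: h; lia.
Qed.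

(* A spot out of reach of all remaining cars stays empty. *)
Lemma all_park_stuck n k g occ p : 0 < g <= n -> g \notin occ -> uniq occ ->
  (forall x, x \in occ -> 0 < x <= n) -> (forall b, b \in p -> g + k < b <= n) ->
  size occ + size p = n -> all_park n k occ p = false.
Proof.
move=> hg; elim: p occ => [|b p IHp] occ go uo so hp sz.
  case/negP: go; apply: (uniq_interval_full _ n) => //.
  by move: sz => /=; lia.
rewrite /=; case E : naples_spot => [s|] //.
have hb := hp b (mem_head _ _).
case: (naples_spot_some _ _ _ _ _ _ E) => [|sno sn sk _ _]; first by lia.
apply: IHp => /=.
- by rewrite inE negb_or go andbT; apply/eqP; lia.
- by rewrite sno.
- by move=> x; rewrite inE => /orP[/eqP->|/so].
- by move=> x xp; apply: hp; rewrite inE xp orbT.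
- by move: sz => /=; lia.
Qed.

(* When only the first i spots have been preferred and there are fewer than i
   cars, the leftmost empty spot is i - r + 1; otherwise the cars fill an
   initial interval. *)
Definition park_inv (i r : nat) (occ : seq nat) : Prop :=
  [/\ uniq occ, forall x, x \in occ -> 0 < x <= maxn i (size occ) &
      size occ < i -> [/\ 0 < r <= i,
        forall x, 0 < x <= i - r -> x \in occ & (i - r).+1 \notin occ]].

Lemma park_inv0 i occ r : i <= size occ -> park_inv i r occ -> park_inv i 0 occ.
Proof. by move=> h [? ? _]; split=> //; lia. Qed.

(** An existing gap stays put, as i.+1 - r.+1 = i - r; if the cars fill exactly 1, ..., i, the new
    spot becomes the gap. *)
Lemma park_inv_next i r occ : (i <= size occ -> r = 0) -> park_inv i r occ ->
  park_inv i.+1 r.+1 occ.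
Proof.
move=> h0 [uo so gap]; split=> //.
  by move=> x /so; lia.
move=> hs; rewrite subSS; have [hi|hi] := ltnP (size occ) i.
  by case: (gap hi) => ? ? ?; split=> //; lia.
rewrite h0 // subn0 ltnS; have e : size occ = i by lia.
split=> //.
  by apply: (uniq_interval_full _ i) => // y /so; lia.
by apply/negP => /so; lia.
Qed.

(** If 1, ..., a is full, the car extends the initial interval. Otherwise the leftmost empty spot is
    a - r, within reach since r <= k, so the car parks at or before a. As it takes the nearest empty
    spot, it fills a - r only when no other spot up to a is empty, and then the deficiency is
    over. *)
Lemma park_inv_car n k a r occ : 0 < a <= n -> r <= k -> size occ < n ->
  park_inv a r.+1 occ ->
  exists2 s, naples_spot n k occ a = Some s & park_inv a r.+1 (s :: occ).
Proof.
move=> ha hr hn [uo so gap].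
have [hs|hs] := leqP a (size occ).
  have full : forall x, 0 < x <= size occ -> x \in occ.
    by apply: uniq_interval_full => // x /so; lia.
  have nS : (size occ).+1 \notin occ by apply/negP => /so; lia.
  case E : naples_spot => [s|]; last first.
    by case/negP: nS; apply: (naples_spot_none _ _ _ _ _ ha E); lia.
  case: (naples_spot_some _ _ _ _ _ ha E) => sno sn sk _ up.
  have s1 : size occ < s by rewrite ltnNge; apply/negP => h; case/negP: sno; apply: full; lia.
  have es : s = (size occ).+1.
    apply/eqP; rewrite eqn_leq s1 andbT leqNgt; apply/negP => h.
    by case/negP: nS; apply: up; lia.
  exists s => //; split=> /=; [by rewrite sno| |lia].
  by move=> x; rewrite inE => /orP[/eqP->|/so]; lia.
have [/andP[_ hra] low gno] := gap hs.
have /allPn[t] : ~~ all (mem occ) (iota 1 a).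
  apply/negP => /allP h; suff : a <= size occ by lia.
  by apply: interval_size_le => x hx; apply: h; rewrite mem_iota; lia.
rewrite mem_iota /= => ta tno.
have tg : a - r.+1 < t by rewrite ltnNge; apply/negP => h; case/negP: tno; apply: low; lia.
case E : naples_spot => [s|]; last first.
  by case/negP: tno; apply: (naples_spot_none _ _ _ _ _ ha E); lia.
case: (naples_spot_some _ _ _ _ _ ha E) => sno sn sk dn up.
have sa : s <= a.
  by rewrite leqNgt; apply/negP => h; case/negP: tno; apply: up; lia.
exists s => //; split=> /=; first by rewrite sno.
  by move=> x; rewrite inE => /orP[/eqP->|/so]; lia.
move=> hs1; split=> //.
  by move=> x hx; rewrite inE low ?orbT.
rewrite inE negb_or gno andbT; apply/eqP => es.
suff : a <= size (s :: occ) by rewrite /=; lia.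
apply: interval_size_le => x hx; rewrite inE.
have [h|h|->] := ltngtP x s; last by [].
- by apply: low; lia.
- by apply: dn; lia.
Qed.

Lemma park_inv_column n k a r c occ : 0 < a <= n -> r <= k -> size occ + c <= n ->
  park_inv a r.+1 occ ->
  exists occ', [/\ park_inv a r.+1 occ', size occ' = size occ + c &
    forall p, all_park n k occ (nseq c a ++ p) = all_park n k occ' p].
Proof.
move=> ha hr; elim: c occ => [|c IHc] occ hc inv.
  by exists occ; rewrite addn0.
have [|s E inv'] := park_inv_car n k a r occ ha hr _ inv; first by lia.
have [|occ' [i1 i2 i3]] := IHc _ _ inv'; first by move=> /=; lia.
exists occ'; split=> //; first by rewrite i2 /=; lia.
by move=> p; rewrite /= E i3.
Qed.

(** * Listing the ascending preferences *)

(** The recursion copies that of [completions]; for q'.+1 <= n, [n - q'] is the first of the last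
    q'.+1 spots. *)
Fixpoint sorted_prefs (n q m : nat) : seq (seq nat) :=
  if q is q'.+1 then
    [seq nseq (m - m') (n - q') ++ s | m' <- iota 0 m.+1, s <- sorted_prefs n q' m']
  else if m == 0 then [:: [::]] else [::].

Lemma sorted_prefsSP n q m (p : seq nat) :
  reflect (exists (m' : nat) (s : seq nat),
             [/\ m' <= m, s \in sorted_prefs n q m' & p = nseq (m - m') (n - q) ++ s])
          (p \in sorted_prefs n q.+1 m).
Proof.
apply: (iffP allpairsPdep) => -[m' [s [hm hs ep]]]; exists m', s; split=> //.
  by move: hm; rewrite mem_iota.
by rewrite mem_iota.
Qed.

Lemma mem_sorted_prefs n q m (p : seq nat) : q <= n ->
  (p \in sorted_prefs n q m) =
    [&& size p == m, sorted leq p & all (fun x => n - q < x <= n) p].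
Proof.
elim: q m p => [|q IHq] m p hq.
  rewrite /= subn0; case: p => [|x p] /=; first by case: m.
  have -> : (n < x <= n) = false by lia.
  by rewrite !andbF; case: m.
apply/sorted_prefsSP/idP => [[m' [s [hm']]]|].
  rewrite IHq; last by lia.
  case/and3P=> /eqP es so al ->.
  rewrite size_cat size_nseq es subnK ?eqxx //=.
  apply/andP; split.
    elim: (m - m') => [|c IHc] //=; rewrite path_min_sorted //.
    rewrite all_cat all_nseq leqnn orbT /=.
    by apply: sub_all al => x; lia.
  rewrite all_cat all_nseq; apply/andP; split; first by lia.
  by apply: sub_all al => x; lia.
case/and3P=> /eqP <- {m}; elim: p => [_ _|x p IHp].
  by exists 0, [::]; rewrite IHq //; lia.
rewrite /= => so /andP[hx al]; case: (eqVneq x (n - q)) => [ex|nx].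
  have [m' [s [hm' hs ep]]] := IHp (path_sorted so) al.
  exists m', s; split=> //; first by lia.
  by rewrite subSn // {1}ep ex.
(* A head beyond the first available spot means an empty first block, so all cars are left over. *)
exists (size p).+1, (x :: p); rewrite subnn; split=> //.
rewrite IHq ?eqxx /=; last by lia.
rewrite so /=; apply/andP; split; first by lia.
move: so; rewrite path_sortedE; last exact: leq_trans.
case/andP=> /allP h _; apply/allP => y yp.
by have := h _ yp; have := allP al _ yp; lia.
Qed.

Lemma uniq_sorted_prefs n q m : q <= n -> uniq (sorted_prefs n q m).
Proof.
elim: q m => [|q IHq] m hq; first by rewrite /=; case: ifP.
apply: (@allpairs_uniq_dep _ (fun=> seq nat) _
  (fun m' s => nseq (m - m') (n - q) ++ s) _ (sorted_prefs n q)).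
- exact: iota_uniq.
- by move=> m' _; apply: IHq; lia.
move=> [a s] [b t] /allpairsPdep[a' [s' [ha hs ->]]] /allpairsPdep[b' [t' [hb ht ->]]] /=.
move: hs ht; rewrite !mem_sorted_prefs; try lia.
case/and3P=> /eqP sa _ al /and3P[/eqP sb _ bl] e.
suff e' : s' = t' by move: sa sb; rewrite e' => -> ->.
(* Deleting the first block recovers the tail, whose size then recovers m'. *)
have F u : all (fun x => n - q < x <= n) u -> forall c,
    [seq x <- nseq c (n - q) ++ u | n - q < x] = u.
  move=> /allP hu c; rewrite filter_cat filter_nseq ltnn /=.
  by apply/all_filterP/allP => x /hu /andP[].
by rewrite -(F _ al (m - a')) e F.
Qed.

Lemma count_sorted_prefsS n q m (P : pred (seq nat)) :
  count P (sorted_prefs n q.+1 m) =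
    \sum_(m' < m.+1) count (fun s => P (nseq (m - m') (n - q) ++ s)) (sorted_prefs n q m').
Proof.
have -> : sorted_prefs n q.+1 m = flatten
  [seq [seq nseq (m - m') (n - q) ++ s | s <- sorted_prefs n q m'] | m' <- iota 0 m.+1].
  by [].
rewrite count_flatten -map_comp sumnE big_map -(big_mkord xpredT
  (fun m' => count (fun s => P (nseq (m - m') (n - q) ++ s)) (sorted_prefs n q m'))).
rewrite /index_iota subn0; apply: eq_bigr => m' _ /=.
by rewrite count_map; apply: eq_count.
Qed.

Lemma eq_in_count0 (T : eqType) (P : pred T) s : {in s, forall x, P x = false} -> count P s = 0.
Proof. by move=> h; rewrite (eq_in_count (a2 := pred0)) ?count_pred0. Qed.

(** * From parking functions to paths *)

(** The gap n - q - r + 1 lies more than k places before every spot still to be preferred. *)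
Lemma count_all_park_stuck n k q m r occ : q <= n -> size occ + m = n ->
  park_inv (n - q) r occ -> k < r -> q < m ->
  count (all_park n k occ) (sorted_prefs n q m) = 0.
Proof.
move=> hq sz [uo so gap] hr hm; have [|hrn _ gno] := gap; first by lia.
apply: eq_in_count0 => p; rewrite mem_sorted_prefs // => /and3P[/eqP sp _ /allP hp].
apply: (all_park_stuck _ _ _ _ _ _ gno uo).
- by lia.
- by move=> x /so; lia.
- by move=> b /hp; lia.
- by rewrite sp.
Qed.

(** The occupied set enters only through the invariant, so the count depends on q, m, r and k
    alone. *)
Lemma count_all_park n k q m r occ : q <= n -> size occ + m = n ->
  park_inv (n - q) r occ -> (m <= q -> r = 0) ->
  count (all_park n k occ) (sorted_prefs n q m) = completions k q m r.
Proof.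
elim: q m r occ => [|q IHq] m r occ hq sz inv h0; have [hr|hr] := ltnP k r.
- by rewrite completions_gt // (count_all_park_stuck _ _ _ _ r) //; case: ltnP => // /h0; lia.
- by rewrite completions0 //=; case: m sz h0.
- by rewrite completions_gt // (count_all_park_stuck _ _ _ _ r) //; case: ltnP => // /h0; lia.
rewrite count_sorted_prefsS completionsS //; apply: eq_bigr => m' _.
have hm' := ltn_ord m'.
have inv' : park_inv (n - q) r.+1 occ.
  rewrite (_ : n - q = (n - q.+1).+1); last by lia.
  by apply: park_inv_next => // hs; apply: h0; lia.
have [||occ' [inv2 sz' E]] := park_inv_column n k (n - q) r (m - m') occ _ hr _ inv'; try lia.
rewrite (eq_count E).
case: ifP => h; apply: IHq; try lia; last by [].
by apply: park_inv0 inv2; lia.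
Qed.

Lemma count_all_park_start n k :
  count (all_park n k [::]) (sorted_prefs n n n) = completions k n n 0.
Proof. by apply: count_all_park; rewrite ?subnn. Qed.

Lemma count_all_park_one n k :
  count (fun p => all_park n k [::] p && (ohead p == Some 1)) (sorted_prefs n n n) =
    rooted_completions k n.
Proof.
case: n => [|n]; first by [].
rewrite count_sorted_prefsS big_ord_recr /= subnn subSnn.
(* The top term, where no car prefers spot 1, vanishes. *)
rewrite [X in _ + X]eq_in_count0 ?addn0; last first.
  move=> p; rewrite mem_sorted_prefs // => /and3P[_ _]; case: p => [|x p] /=.
    by [].
  case/andP=> hx _; suff -> : (Some x == Some 1) = false by rewrite andbF.
  by apply/eqP => -[]; lia.
apply: eq_bigr => m _; have hm := ltn_ord m.
(* Before any car arrives spot 1 is the gap, hence r = 1; the first column is nonempty, so it fills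
   spot 1 and the run resets to 0. *)
have inv : park_inv 1 1 [::] by split=> // _; split=> // x; lia.
have [|||occ' [inv2 sz' E]] := park_inv_column n.+1 k 1 0 (n.+1 - m) [::] _ _ _ inv; try by rewrite /=; lia.
rewrite -(count_all_park n.+1 k n m 0 occ'); try lia.
- apply: eq_count => p; rewrite -E /=.
  by rewrite (_ : ohead _ = Some 1) ?andbT // subSn //; lia.
- by rewrite sz' /=; lia.
by rewrite subSnn; apply: park_inv0 inv2; rewrite sz' /=; lia.
Qed.

Lemma card_ascending n (P : pred (seq nat)) :
  #|[set t : n.-tuple 'I_n | ascending t & P (prefs t)]| = count P (sorted_prefs n n n).
Proof.
have prefs_inj : injective (@prefs n).
  move=> s t; rewrite /prefs => /inj_map e; apply: val_inj; apply: e.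
  by move=> i j [] /val_inj.
rewrite -size_filter cardE -(size_map (@prefs n)); apply/perm_size/uniq_perm.
- by rewrite map_inj_uniq // enum_uniq.
- by rewrite filter_uniq // uniq_sorted_prefs.
move=> p; rewrite mem_filter mem_sorted_prefs // subnn; apply/mapP/idP.
  case=> t; rewrite mem_enum inE /ascending => /andP[so Pt] ->.
  rewrite Pt so size_map size_tuple eqxx /=.
  by apply/allP => x /mapP[i _ ->]; apply: ltn_ord.
case/and4P=> Pp /eqP sp so /allP al.
case: n prefs_inj sp al => [|n] prefs_inj sp al.
  have ep : p = [::] by case: (p) sp.
  exists [tuple]; last by rewrite /prefs ep.
  by rewrite mem_enum inE /ascending /prefs /= -ep.
have st : size [seq (inord x.-1 : 'I_n.+1) | x <- p] == n.+1 by rewrite size_map sp.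
have e : prefs (Tuple st) = p.
  rewrite /prefs /= -map_comp -[RHS]map_id; apply/eq_in_map => x /al hx /=.
  by rewrite inordK; lia.
by exists (Tuple st); rewrite ?mem_enum ?inE /ascending e ?so.
Qed.

Lemma I_numE n k : I_num n k = completions k n n 0.
Proof. by rewrite -count_all_park_start -card_ascending. Qed.

Lemma U_numE n k : U_num n k = rooted_completions k n.
Proof. by rewrite -count_all_park_one -card_ascending. Qed.

(** * Passage to power series *)

(** Natural subtraction truncates: when n - i < k the summand reads [g 0], so [g 0 = 0] removes the
    terms that the product does not have. *)
Lemma fps_monomial_mul c k (f g : fps) n : g 0 = 0%R ->
  (fps_monomial c k * f * g)%fps n = (c * \sum_(i < n.+1) f i * g (n - i - k)%N)%R.
Proof.
move=> g0.
have E j : (fps_monomial c k * f)%fps j = (if (k <= j)%N then c * f (j - k)%N else 0)%R.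
  rewrite /fps_mul /fps_monomial; case: leqP => h.
    rewrite (bigD1 (inord k)) //= inordK // eqxx big1 ?addr0 // => i hi.
    case: eqP => [e|_]; last by rewrite mul0r.
    by case/eqP: hi; apply: val_inj; rewrite /= inordK.
  by apply: big1 => i _; case: eqP (ltn_ord i) => [->|_ _]; [lia|rewrite mul0r].
rewrite {1}/fps_mul big_distrr /=.
have [h|h] := leqP k n; last first.
  rewrite !big1 // => i _; last by rewrite E leqNgt (leq_trans _ h) ?mul0r // -ltnS.
  by rewrite (_ : n - i - k = 0)%N ?g0 ?mulr0 //; lia.
rewrite -(big_mkord xpredT (fun i => (fps_monomial c k * f)%fps i * g (n - i)%N)%R).
rewrite -(big_mkord xpredT (fun i => c * (f i * g (n - i - k)%N))%R).
rewrite (@big_cat_nat _ _ _ k) //=; last by lia.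
rewrite big_nat big1 => [|i hi]; last by rewrite E leqNgt (_ : i < k) ?mul0r //; lia.
rewrite [RHS](@big_cat_nat _ _ _ (n.+1 - k)) //=; last by lia.
rewrite add0r [X in (_ + X)%R]big_nat [X in (_ + X)%R]big1 => [|i hi]; last first.
  by rewrite (_ : n - i - k = 0)%N ?g0 ?mulr0 //; lia.
rewrite addr0 -{1}[k]add0n big_addn; apply: eq_bigr => i _.
by rewrite E leq_addl addnK mulrA subnDA subnAC.
Qed.

Theorem theorem5p6 (k : nat) (hk : (1 <= k)%N) :
  (I_gf k =1
     (I_gf k.-1 + fps_monomial (catalan k)%:Z%R k * I_gf k.-1 * U_gf k)%fps) /\
  (U_gf k =1
     (U_gf k.-1 + fps_monomial (catalan k)%:Z%R k * U_gf k.-1 * U_gf k)%fps).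
Proof.
case: k hk => // K _ /=.
have U0 : U_gf K.+1 0 = 0%R by rewrite /U_gf U_numE.
split=> n; rewrite /fps_add fps_monomial_mul // /I_gf /U_gf.
  rewrite !I_numE completions_rec PoszD PoszM; congr (_ + _ * _)%R.
  rewrite (big_morph Posz PoszD (erefl _)); apply: eq_bigr => i _.
  by rewrite PoszM I_numE U_numE.
rewrite !U_numE rooted_completions_rec PoszD PoszM; congr (_ + _ * _)%R.
rewrite (big_morph Posz PoszD (erefl _)); apply: eq_bigr => i _.
by rewrite PoszM !U_numE.
Qed.
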